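(* For every integer $j \geq 3$, $$m_j(B, K_{1,3}+e) = \begin{cases} \infty & \text{if } j \in \{3,4,5\},\\ 2 & \text{if } j \in \{6,7,8\},\\ 1 & \text{otherwise.}\end{cases}$$
   Context: All graphs are simple. $K_{j\times s}$ denotes the complete multipartite graph with $j$ partite sets, each of size $s$. The Butterfly graph $B$ is the graph on 5 vertices consisting of two copies of the triangle $C_3$ sharing exactly one common vertex. $K_{1,3}+e$ is the graph on 4 vertices obtained from the star $K_{1,3}$ by adding one edge between two of its leaves (a triangle with a pendant edge). For graphs $B$ and $G$ and an integer $j\ge 2$, the size multipartite Ramsey number $m_j(B,G)$ is the smallest natural number $s$ such that every colouring of the edges of $K_{j\times s}$ with two colours, red and blue, contains a red copy of $B$ or a blue copy of $G$; if no such $s$ exists, $m_j(B,G)=\infty$. *)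

(* Defs.v *)
From HB Require Import structures.
From Stdlib Require Import ClassicalEpsilon.
From mathcomp Require Import all_boot.

Set Implicit Arguments.
Unset Strict Implicit.
Unset Printing Implicit Defensive.

Record sgraph := SGraph {
  vertex :> finType;
  adj : rel vertex;
  adj_sym : symmetric adj;
  adj_irr : irreflexive adj
}.

Section EdgeList.
Variables (n : nat) (E : seq (nat * nat)).

Definition edge_list_rel : rel 'I_n := fun x y =>
  (x != y) && (((val x, val y) \in E) || ((val y, val x) \in E)).

Lemma edge_list_sym : symmetric edge_list_rel.
Proof. by move=> x y; rewrite /edge_list_rel eq_sym orbC. Qed.

Lemma edge_list_irr : irreflexive edge_list_rel.
Proof. by move=> x; rewrite /edge_list_rel eqxx. Qed.

Definition edge_list_graph : sgraph := SGraph edge_list_sym edge_list_irr.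
End EdgeList.

(* The triangles 0-1-2 and 0-3-4, sharing the vertex 0. *)
Definition butterfly : sgraph :=
  edge_list_graph 5 [:: (0, 1); (0, 2); (1, 2); (0, 3); (0, 4); (3, 4)].

(* K_{1,3}+e: the star with centre 0 and leaves 1, 2, 3, plus the edge 1-2. *)
Definition K13_plus_e : sgraph :=
  edge_list_graph 4 [:: (0, 1); (0, 2); (0, 3); (1, 2)].

Section CompleteMultipartite.
Variables (j s : nat).

(* The vertex (p, k) is the k-th vertex of the partite set p. *)
Definition multipartite_rel : rel ('I_j * 'I_s)%type :=
  fun u v => u.1 != v.1.

Lemma multipartite_sym : symmetric multipartite_rel.
Proof. by move=> u v; rewrite /multipartite_rel eq_sym. Qed.

Lemma multipartite_irr : irreflexive multipartite_rel.
Proof. by move=> u; rewrite /multipartite_rel eqxx. Qed.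

Definition complete_multipartite : sgraph :=
  SGraph multipartite_sym multipartite_irr.
End CompleteMultipartite.

(* A 2-colouring assigns a Boolean to every set of vertices; only its values on
   the edges {x, y} of G are ever used. *)
Definition coloring (G : sgraph) := {ffun {set G} -> bool}.

Section ColorClass.
Variables (G : sgraph) (c : coloring G) (b : bool).

Definition color_rel : rel G :=
  fun x y => adj x y && (c [set x; y] == b).

Lemma color_sym : symmetric color_rel.
Proof. by move=> x y; rewrite /color_rel adj_sym setUC. Qed.

Lemma color_irr : irreflexive color_rel.
Proof. by move=> x; rewrite /color_rel adj_irr. Qed.

Definition color_class : sgraph := SGraph color_sym color_irr.
End ColorClass.

Definition red_graph (G : sgraph) (c : coloring G) : sgraph :=
  color_class c true.
Definition blue_graph (G : sgraph) (c : coloring G) : sgraph :=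
  color_class c false.

(* Copies are subgraphs, not necessarily induced. *)
Definition contains_copy (G H : sgraph) : bool :=
  [exists f : {ffun H -> G}, injectiveb f &&
    [forall x : H, forall y : H, adj x y ==> adj (f x) (f y)]].

Definition arrows (F B G : sgraph) : bool :=
  [forall c : coloring F,
     contains_copy (red_graph c) B || contains_copy (blue_graph c) G].

(* [None] stands for infinity. *)
Definition size_multipartite_ramsey (j : nat) (B G : sgraph) : option nat :=
  match excluded_middle_informative
          (exists s, arrows (complete_multipartite j s) B G) with
  | left ex_s => Some (ex_minn ex_s)
  | right _ => None
  end.

(* Main.v *)
Require Import Defs.
From Stdlib Require Import ClassicalEpsilon.
From mathcomp Require Import all_boot.
From mathcomp Require Import zify.

Set Implicit Arguments.
Unset Strict Implicit.
Unset Printing Implicit Defensive.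

(* Upper bounds.  A blue triangle is joined in red to everything else, so any six
   vertices off its three parts span at most one red edge, which is impossible;
   hence blue is triangle-free.  A blue neighbourhood is then red, so it has at
   most four vertices.  For s = 2, j >= 6 some red neighbourhood thus has six
   vertices; it contains two disjoint triples, each spanning a red edge, and
   these two edges close up to a red butterfly.  For s = 1, j >= 9 a red
   neighbourhood has four vertices and contains a red triangle, whence a red
   K_4; each other vertex has at most one red neighbour in it, so any two of
   the other vertices have a common blue neighbour and are joined in red: this
   gives a red K_5.
   Lower bounds.  For j <= 5, blow up the colouring of K_5 by two pentagons,
   which has no monochromatic triangle; for j <= 8 and s = 1, let red be two
   disjoint copies of K_4. *)

Ltac split_andb :=
  repeat match goal with H : is_true (_ && _) |- _ =>
    let H1 := fresh "H" in let H2 := fresh "H" in move/andP: H => [H1 H2] end.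

Ltac distinct :=
  repeat match goal with H : is_true (uniq _) |- _ =>
    move: H; rewrite /= ?inE ?negb_or ?andbT => H end;
  split_andb; rewrite /= ?inE ?negb_or ?andbT;
  repeat (apply/andP; split); first [assumption | rewrite eq_sym; assumption | done].

(** * Copies of the butterfly and of the paw $K_{1,3}+e$; colourings from relations *)

Section ForbiddenSubgraphs.

Variable G : sgraph.

Lemma contains_butterfly (v a b c d : G) :
  uniq [:: v; a; b; c; d] -> adj v a -> adj v b -> adj a b ->
  adj v c -> adj v d -> adj c d -> contains_copy G butterfly.
Proof.
move=> Us va vb ab vc vd cd.
apply/existsP; exists [ffun i : 'I_5 => nth v [:: v; a; b; c; d] i].
apply/andP; split.
  apply/injectiveP => i k; rewrite !ffunE => /eqP.
  by rewrite nth_uniq ?ltn_ord // => /eqP/val_inj.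
apply/forallP => -[i i5]; apply/forallP => -[k k5]; rewrite !ffunE.
case: i i5 => [|[|[|[|[|//]]]]] i5; case: k k5 => [|[|[|[|[|//]]]]] k5;
  apply/implyP => //= _; by [| rewrite adj_sym].
Qed.

Lemma contains_K13_plus_e (x y z w : G) :
  uniq [:: x; y; z; w] -> adj x y -> adj x z -> adj y z -> adj x w ->
  contains_copy G K13_plus_e.
Proof.
move=> Us xy xz yz xw.
apply/existsP; exists [ffun i : 'I_4 => nth x [:: x; y; z; w] i].
apply/andP; split.
  apply/injectiveP => i k; rewrite !ffunE => /eqP.
  by rewrite nth_uniq ?ltn_ord // => /eqP/val_inj.
apply/forallP => -[i i4]; apply/forallP => -[k k4]; rewrite !ffunE.
case: i i4 => [|[|[|[|//]]]] i4; case: k k4 => [|[|[|[|//]]]] k4;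
  apply/implyP => //= _; by [| rewrite adj_sym].
Qed.

Lemma contains_copyP (H : sgraph) :
  reflect (exists2 f : H -> G, injective f & forall x y, adj x y -> adj (f x) (f y))
          (contains_copy G H).
Proof.
apply: (iffP existsP) => [[f /andP[/injectiveP injf /forallP fP]]|[f injf fP]].
  by exists f => // x y; move: (fP x) => /forallP/(_ y)/implyP.
exists (finfun f); apply/andP; split.
  by apply/injectiveP => x y; rewrite !ffunE => /injf.
apply/forallP => x; apply/forallP => y; apply/implyP => xy.
by rewrite !ffunE; apply: fP.
Qed.

Lemma butterfly_triangle :
  contains_copy G butterfly -> exists x y z : G, [/\ adj x y, adj x z & adj y z].
Proof.
move=> /contains_copyP[f _ fP].
exists (f (inord 0)), (f (inord 1)), (f (inord 2)).
by split; apply: fP; rewrite /= /edge_list_rel -val_eqE /= !inordK.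
Qed.

Lemma K13_plus_e_triangle :
  contains_copy G K13_plus_e -> exists x y z : G, [/\ adj x y, adj x z & adj y z].
Proof.
move=> /contains_copyP[f _ fP].
exists (f (inord 0)), (f (inord 1)), (f (inord 2)).
by split; apply: fP; rewrite /= /edge_list_rel -val_eqE /= !inordK.
Qed.

(** Vertex 0 of the butterfly is adjacent to all the others, so a label that is constant along edges
    takes the value of the centre on the whole copy. *)
Lemma butterfly_connected (C : eqType) (col : G -> C) :
  (forall x y : G, adj x y -> col x = col y) -> contains_copy G butterfly ->
  exists2 f : 'I_5 -> G, injective f & forall i k, col (f i) = col (f k).
Proof.
move=> colP /contains_copyP[f injf fP]; exists f => //.
suff f0 i : col (f ord0) = col (f i) by move=> i k; rewrite -!f0.
have [->//|i0] := eqVneq i ord0.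
apply: colP; apply: fP; move: i0; case: i => [[|[|[|[|[|//]]]]] i5] //=.
Qed.

Lemma coloring_of_rel (r : rel G) : symmetric r ->
  exists c : coloring G, forall b x y, color_rel c b x y = adj x y && (r x y == b).
Proof.
move=> rC.
(* On an edge [[set x; y]] the only adjacent ordered pairs are [(x, y)] and [(y, x)], on which [r]
   agrees by symmetry. *)
exists [ffun S : {set G} => [exists x in S, exists y in S, adj x y && r x y]].
move=> b x y; rewrite /color_rel ffunE; case xy : (adj x y) => //=.
congr (_ == b); apply/existsP/idP => [[u]|rxy].
  rewrite !inE => /andP[/orP[]/eqP-> /existsP[w]]; rewrite !inE;
    move=> /andP[/orP[]/eqP->]; rewrite ?adj_irr //= => /andP[_] //.
  by rewrite rC.
exists x; rewrite !inE eqxx; apply/existsP; exists y.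
by rewrite !inE eqxx orbT xy.
Qed.

End ForbiddenSubgraphs.

(* The colour classes are seen as two relations covering a complete
   multipartite graph, [part] being the index of the partite set. *)
Section TwoColours.

Variables (T : finType) (part : T -> nat) (red blue : rel T).
Hypothesis red_sym : symmetric red.
Hypothesis blue_sym : symmetric blue.
Hypothesis cover : forall x y, part x != part y -> red x y || blue x y.
Hypothesis no_butterfly : forall v a b c d, uniq [:: v; a; b; c; d] ->
  red v a -> red v b -> red a b -> red v c -> red v d -> red c d -> False.
Hypothesis no_paw : forall x y z w, uniq [:: x; y; z; w] ->
  blue x y -> blue x z -> blue y z -> blue x w -> False.
Hypothesis part2 : forall a b c, uniq [:: a; b; c] ->
  part a = part b -> part b = part c -> False.

(** * Choosing vertices in different parts *)

Lemma sorted_by_part (S : {set T}) :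
  exists s, [/\ uniq s, {subset s <= S}, size s = #|S| &
    sorted (fun x y => part x <= part y) s].
Proof.
exists (sort (fun x y => part x <= part y) (enum S)); split.
- by rewrite sort_uniq enum_uniq.
- by move=> x; rewrite mem_sort mem_enum.
- by rewrite size_sort -cardE.
- by apply: sort_sorted => x y; apply: leq_total.
Qed.

(* In a list sorted by part, vertices at distance two lie in different parts. *)
Lemma part_lt a b c : uniq [:: a; b; c] -> part a <= part b -> part b <= part c ->
  part a < part c.
Proof.
move=> U ab bc; rewrite ltn_neqAle (leq_trans ab bc) andbT; apply/eqP => ac.
by apply: (part2 U); lia.
Qed.

Lemma five_vertices (S : {set T}) : 5 <= #|S| ->
  exists a b c d e, [/\ uniq [:: a; b; c; d; e],
    {subset [:: a; b; c; d; e] <= S},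
    [/\ part a <= part b, part b <= part c, part c <= part d & part d <= part e] &
    [/\ part a < part c, part b < part d & part c < part e]].
Proof.
have [s [U sS <-]] := sorted_by_part S.
case: s U sS => [|a[|b[|c[|d[|e s]]]]] //.
rewrite -[[:: a, b, c, d, e & s]]/([:: a; b; c; d; e] ++ s) cat_uniq.
move=> /andP[U _] sS /= /and5P[ab bc cd de _] _.
exists a, b, c, d, e; split => //; first by move=> x xs; apply: sS; rewrite mem_cat xs.
by split; apply: part_lt; try eassumption; distinct.
Qed.

Lemma two_triples (S : {set T}) : 6 <= #|S| ->
  exists a b c d e f, [/\ uniq [:: a; b; c; d; e; f],
    {subset [:: a; b; c; d; e; f] <= S}, part a < part b < part c &
    part d < part e < part f].
Proof.
have [s [U sS <-]] := sorted_by_part S.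
case: s U sS => [|a[|b[|c[|d[|e[|f s]]]]]] //.
rewrite -[[:: a, b, c, d, e, f & s]]/([:: a; b; c; d; e; f] ++ s) cat_uniq.
move=> /andP[U _] sS /= /and5P[ab bc cd de /andP[ef _]] _.
(* Taking every other entry of the sorted list puts the members of each triple in three different
   parts. *)
exists a, c, e, b, d, f; split.
- by distinct.
- move=> x xs; apply: sS; rewrite mem_cat; apply/orP; left; move: xs.
  by rewrite !inE; case/or4P=> [->|->|->|/or3P[]->]; rewrite ?orbT.
- by apply/andP; split; apply: part_lt; try eassumption; distinct.
- by apply/andP; split; apply: part_lt; try eassumption; distinct.
Qed.

(** * Excluding blue triangles *)

Lemma red_off_blue_triangle x y z w : uniq [:: x; y; z; w] ->
  blue x y -> blue x z -> blue y z -> part w != part x -> red w x.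
Proof.
move=> U xy xz yz wx; case/orP: (cover wx) => //; rewrite blue_sym => xw.
by case: (no_paw U).
Qed.

Lemma transversal_triple a b c : part a < part b < part c ->
  [\/ red a b, red a c, red b c | [/\ blue a b, blue a c & blue b c]].
Proof.
move=> /andP[ab bc].
have /orP[|rab] : red a b || blue a b by apply: cover; lia.
  by constructor 1.
have /orP[|rac] : red a c || blue a c by apply: cover; lia.
  by constructor 2.
have /orP[|rbc] : red b c || blue b c by apply: cover; lia.
  by constructor 3.
by constructor 4.
Qed.

Lemma blue_triangle_free x y z :
  6 <= #|[set w | part w \notin [:: part x; part y; part z]]| ->
  uniq [:: x; y; z] -> blue x y -> blue x z -> blue y z -> False.
Proof.
set S := [set w | _] => S6 U xy xz yz.
have [yx zx zy] : [/\ blue y x, blue z x & blue z y] by split; rewrite blue_sym.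
have Sne w : w \in S -> uniq [:: x; y; z; w].
  rewrite inE !inE !negb_or => /and3P[wx wy wz].
  have nx : w != x by apply: contraNneq wx => ->.
  have ny : w != y by apply: contraNneq wy => ->.
  have nz : w != z by apply: contraNneq wz => ->.
  by distinct.
have redS w : w \in S -> [/\ red w x, red w y & red w z].
  move=> wS; have := Sne _ wS; move: wS; rewrite inE !inE !negb_or.
  move=> /and3P[wx wy wz] Uw.
  split; [apply: (@red_off_blue_triangle x y z) | apply: (@red_off_blue_triangle y x z)
         | apply: (@red_off_blue_triangle z x y)] => //; distinct.
have [a [b [c [d [e [f [Us sS abc def]]]]]]] := two_triples S6.
have [aS bS cS] : [/\ a \in S, b \in S & c \in S].
  by split; apply: sS; rewrite !inE eqxx ?orbT.
have [dS eS fS] : [/\ d \in S, e \in S & f \in S].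
  by split; apply: sS; rewrite !inE eqxx ?orbT.
(* Two disjoint red edges in [S] form a butterfly centred at [x]. *)
have disj p q r s : p \in S -> q \in S -> r \in S -> s \in S ->
    uniq [:: p; q; r; s] -> red p q -> red r s -> False.
  move=> pS qS rS sS' Upq pq rs.
  have [[px _ _] [qx _ _] [rx _ _] [sx _ _]] :=
    And4 (redS _ pS) (redS _ qS) (redS _ rS) (redS _ sS').
  have [Up Uq Ur Us'] := And4 (Sne _ pS) (Sne _ qS) (Sne _ rS) (Sne _ sS').
  apply: (@no_butterfly x p q r s) => //; rewrite 1?red_sym //; distinct.
(* Two red edges meeting at [p] form a butterfly centred at [p]: one is closed by [x], the other by
   [y]. *)
have path p q r : p \in S -> q \in S -> r \in S ->
    uniq [:: p; q; r] -> red p q -> red p r -> False.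
  move=> pS qS rS Upq pq pr.
  have [[px py _] [qx _ _] [_ ry _]] := And3 (redS _ pS) (redS _ qS) (redS _ rS).
  have [Up Uq Ur] := And3 (Sne _ pS) (Sne _ qS) (Sne _ rS).
  apply: (@no_butterfly p q x r y) => //; distinct.
(* The vertex [t] shares its part with at most one vertex of a blue triangle [p q r], so it is
   joined in red to the other two, against [path]. *)
have noblue p q r t : p \in S -> q \in S -> r \in S -> t \in S ->
    uniq [:: p; q; r; t] -> part p < part q < part r ->
    [/\ blue p q, blue p r & blue q r] -> False.
  move=> pS qS rS tS Up /andP[lpq lqr] [pq pr qr].
  have [qp rp rq] : [/\ blue q p, blue r p & blue r q].
    by split; rewrite blue_sym.
  have tp : part t != part p -> red t p.
    by apply: (@red_off_blue_triangle p q r) => //; distinct.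
  have tq : part t != part q -> red t q.
    by apply: (@red_off_blue_triangle q p r) => //; distinct.
  have tr : part t != part r -> red t r.
    by apply: (@red_off_blue_triangle r p q) => //; distinct.
  have npq : part p != part q by rewrite neq_ltn lpq.
  have nqr : part q != part r by rewrite neq_ltn lqr.
  have npr : part p != part r by rewrite neq_ltn (ltn_trans lpq lqr).
  have [etp|ntp] := eqVneq (part t) (part p).
    apply: (path t q r) => //; [|by apply: tq; rewrite etp|by apply: tr; rewrite etp].
    by distinct.
  have [etq|ntq] := eqVneq (part t) (part q).
    apply: (path t p r) => //; [|exact: tp|by apply: tr; rewrite etq].
    by distinct.
  apply: (path t p q) => //; [|exact: tp|exact: tq].
  by distinct.
(* Each triple thus contains a red edge, a vertex of the other triple serving as [t]; the two edges
   are disjoint. *)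
case: (transversal_triple abc) => [r1|r1|r1|/(@noblue a b c d)]; last by apply => //; distinct.
all: case: (transversal_triple def) => [r2|r2|r2|/(@noblue d e f a)];
  last by apply => //; distinct.
all: by apply: disj r1 r2 => //; distinct.
Qed.

(** * Degree bounds when blue is triangle-free *)

Hypothesis no_blue_triangle : forall x y z, uniq [:: x; y; z] ->
  blue x y -> blue x z -> blue y z -> False.

(** In the sorted list only consecutive entries can share a part. The centre has to be alone in its
    part: [a] or [e] if possible, and otherwise [c], since then [a], [b] are paired and so are [d],
    [e]. The four remaining vertices are matched so that no two consecutive entries are joined. *)
Lemma no_red_five (S : {set T}) : 5 <= #|S| ->
  (forall x y, x \in S -> y \in S -> part x != part y -> red x y) -> False.
Proof.
move=> S5 redS; have [a [b [c [d [e [U sS [ab bc cd de] [ac bd ce]]]]]]] := five_vertices S5.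
have [[aS bS cS] [dS eS]] : [/\ a \in S, b \in S & c \in S] /\ (d \in S /\ e \in S).
  by split; split; apply: sS; rewrite !inE eqxx ?orbT.
have [nab|eab] := ltnP (part a) (part b).
  apply: (@no_butterfly a b d c e); first (by distinct); by apply: redS => //; lia.
have [nde|ede] := ltnP (part d) (part e).
  apply: (@no_butterfly e a c b d); first (by distinct); by apply: redS => //; lia.
apply: (@no_butterfly c a d b e); first (by distinct); by apply: redS => //; lia.
Qed.

Lemma blue_degree_le4 v : #|[set w | (part w != part v) && blue v w]| <= 4.
Proof.
rewrite leqNgt; apply/negP => /no_red_five; apply => x y; rewrite !inE.
move=> /andP[xv vx] /andP[yv vy] xy; case/orP: (cover xy) => // bxy.
have n1 : x != v by apply: contraNneq xv => ->.
have n2 : y != v by apply: contraNneq yv => ->.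
have n3 : x != y by apply: contraNneq xy => ->.
by case: (@no_blue_triangle v x y) => //; distinct.
Qed.

Lemma red_degree v :
  #|[set w | part w != part v]| <= #|[set w | (part w != part v) && red v w]| + 4.
Proof.
apply: leq_trans (leq_add (leqnn _) (blue_degree_le4 v)).
apply: leq_trans (leq_card_setU _ _); apply: subset_leq_card.
apply/subsetP => w; rewrite !inE => wv; rewrite wv /=; apply: cover.
by rewrite eq_sym.
Qed.

Lemma red_degree_lt6 v : #|[set w | (part w != part v) && red v w]| < 6.
Proof.
rewrite ltnNge; apply/negP; set S := [set w | _] => S6.
have [a [b [c [d [e [f [U sS abc def]]]]]]] := two_triples S6.
have nbr w : w \in [:: a; b; c; d; e; f] -> w != v /\ red v w.
  by move=> /sS; rewrite inE => /andP[wv ->]; split=> //; apply: contraNneq wv => ->.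
have [na va] : a != v /\ red v a by apply: nbr; rewrite !inE eqxx ?orbT.
have [nb vb] : b != v /\ red v b by apply: nbr; rewrite !inE eqxx ?orbT.
have [nc vc] : c != v /\ red v c by apply: nbr; rewrite !inE eqxx ?orbT.
have [nd vd] : d != v /\ red v d by apply: nbr; rewrite !inE eqxx ?orbT.
have [ne ve] : e != v /\ red v e by apply: nbr; rewrite !inE eqxx ?orbT.
have [nf vf] : f != v /\ red v f by apply: nbr; rewrite !inE eqxx ?orbT.
case: (transversal_triple abc) => [r1|r1|r1|[b1 b2 b3]];
  last by apply: (@no_blue_triangle a b c) => //; distinct.
all: case: (transversal_triple def) => [r2|r2|r2|[b1 b2 b3]];
  last by apply: (@no_blue_triangle d e f) => //; distinct.
all: by apply: (@no_butterfly v _ _ _ _ _ _ _ r1 _ _ r2) => //; distinct.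
Qed.

(** * Parts with a single vertex *)

Section SingletonParts.

Hypothesis part_inj : injective part.

Lemma red_or_blue x y : x != y -> red x y || blue x y.
Proof. by move=> xy; apply: cover; rewrite (inj_eq part_inj). Qed.

(** Among four red neighbours of [v], disjoint red edges would give a butterfly at [v]. Pairwise
    meeting edges form a star or a triangle, and a star would leave three vertices spanning a blue
    triangle. *)
Lemma red_triangle_in_nbhd v : 4 <= #|[set w | (part w != part v) && red v w]| ->
  exists a b c, [/\ uniq [:: v; a; b; c], [/\ red v a, red v b & red v c] &
    [/\ red a b, red a c & red b c]].
Proof.
set S := [set w | _] => S4.
have [s [U sS sz _]] := sorted_by_part S; rewrite -sz in S4.
case: s U sS {sz} S4 => [|a[|b[|c[|d s]]]] //.
rewrite -[[:: a, b, c, d & s]]/([:: a; b; c; d] ++ s) cat_uniq.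
move=> /andP[U _] sS _.
have nbr w : w \in [:: a; b; c; d] -> w != v /\ red v w.
  move=> ws; have : w \in S by apply: sS; rewrite mem_cat ws.
  by rewrite inE => /andP[wv ->]; split=> //; apply: contraNneq wv => ->.
have [na va] : a != v /\ red v a by apply: nbr; rewrite !inE eqxx ?orbT.
have [nb vb] : b != v /\ red v b by apply: nbr; rewrite !inE eqxx ?orbT.
have [nc vc] : c != v /\ red v c by apply: nbr; rewrite !inE eqxx ?orbT.
have [nd vd] : d != v /\ red v d by apply: nbr; rewrite !inE eqxx ?orbT.
have cov x y : x != y -> ~~ red x y -> blue x y.
  by move=> /red_or_blue/orP[->|].
have tri x y z : uniq [:: x; y; z] -> [|| red x y, red x z | red y z].
  move=> Ut; apply/negP => /negP; rewrite !negb_or => /and3P[n1 n2 n3].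
  by apply: (no_blue_triangle Ut); apply: cov => //; distinct.
have mat x y z t : red v x -> red v y -> red v z -> red v t ->
    uniq [:: v; x; y; z; t] -> ~~ (red x y && red z t).
  by move=> vx vy vz vt Um; apply/negP => /andP[xy zt]; apply: (no_butterfly Um).
(* The three perfect matchings on the four vertices, then their four triples. *)
have m1 : ~~ (red a b && red c d) by apply: mat => //; distinct.
have m2 : ~~ (red a c && red b d) by apply: mat => //; distinct.
have m3 : ~~ (red a d && red b c) by apply: mat => //; distinct.
have t1 : [|| red a b, red a c | red b c] by apply: tri; distinct.
have t2 : [|| red a b, red a d | red b d] by apply: tri; distinct.
have t3 : [|| red a c, red a d | red c d] by apply: tri; distinct.
have t4 : [|| red b c, red b d | red c d] by apply: tri; distinct.
have : [|| [&& red a b, red a c & red b c], [&& red a b, red a d & red b d],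
           [&& red a c, red a d & red c d] | [&& red b c, red b d & red c d]].
  move: m1 m2 m3 t1 t2 t3 t4.
  by case: (red a b); case: (red a c); case: (red a d); case: (red b c);
    case: (red b d); case: (red c d).
by case/or4P => /and3P[r1 r2 r3];
  [exists a, b, c | exists a, b, d | exists a, c, d | exists b, c, d];
  split => //; distinct.
Qed.

Lemma red_K4_absurd a b c d : 9 <= #|T| -> uniq [:: a; b; c; d] ->
  [/\ red a b, red a c & red a d] -> [/\ red b c, red b d & red c d] -> False.
Proof.
move=> T9 U [ab ac ad] [bc bd cd].
have [ba ca da] : [/\ red b a, red c a & red d a] by split; rewrite red_sym.
have [cb db dc] : [/\ red c b, red d b & red d c] by split; rewrite red_sym.
(* At least five vertices lie outside the red $K_4$; it remains to see that they are pairwise joined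
   in red. *)
apply: (@no_red_five (~: [set x in [:: a; b; c; d]])) => [|x y].
  have -> : 5 = 9 - #|[set x in [:: a; b; c; d]]| by rewrite cardsE (card_uniqP U).
  by rewrite [X in _ <= X]cardsCs setCK leq_sub2r.
rewrite !inE !negb_or => /and4P[xa xb xc xd] /and4P[ya yb yc yd] xy.
have n3 : x != y by apply: contraNneq xy => ->.
(* If [w] is red to both [p] and [q], the triangles [p w q] and [p r s] form a butterfly. *)
have two w p q r s : w != p -> w != q -> w != r -> w != s -> uniq [:: p; q; r; s] ->
    red p q -> red p r -> red p s -> red r s -> ~~ (red w p && red w q).
  move=> wp wq wr ws Up pq pr ps rs; apply/negP => /andP[rwp rwq].
  apply: (@no_butterfly p w q r s) => //; last by rewrite red_sym.
  by distinct.
have at1 w : w != a -> w != b -> w != c -> w != d ->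
  [&& ~~ (red w a && red w b), ~~ (red w a && red w c), ~~ (red w a && red w d),
      ~~ (red w b && red w c), ~~ (red w b && red w d) & ~~ (red w c && red w d)].
  move=> wa wb wc wd.
  rewrite (two w a b c d) ?(two w a c b d) ?(two w a d b c) //; try distinct.
  by rewrite (two w b c a d) ?(two w b d a c) ?(two w c d a b) //; distinct.
have common p : x != p -> y != p -> red x p || red y p || red x y.
  move=> xp yp; case/orP: (red_or_blue n3) => [->|bxy]; first by rewrite orbT.
  case/orP: (red_or_blue xp) => [->//|bxp].
  case/orP: (red_or_blue yp) => [->//|byp]; first by rewrite orbT.
  by case: (@no_blue_triangle x y p) => //; distinct.
have := at1 x xa xb xc xd; have := at1 y ya yb yc yd.
have := common a xa ya; have := common b xb yb.
have := common c xc yc; have := common d xd yd.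
(* If [x y] is not red, each of the four vertices of the $K_4$ is red to [x] or [y], while [x] and
   [y] each account for at most one. *)
case: (red x y) => //; rewrite !orbF.
by case: (red x a); case: (red x b); case: (red x c); case: (red x d);
  case: (red y a); case: (red y b); case: (red y c); case: (red y d).
Qed.

Lemma nine_vertices_absurd : 9 <= #|T| -> False.
Proof.
move=> T9; have /card_gt0P[v _] : 0 < #|T| by apply: leq_trans T9.
have deg : 8 <= #|[set w | part w != part v]|.
  have -> : [set w | part w != part v] = [set~ v].
    by apply/setP => w; rewrite !inE (inj_eq part_inj).
  by rewrite cardsC1; lia.
(* At most four of the eight other vertices are blue neighbours of [v], which leaves four red
   ones. *)
have [|a [b [c [U vabc abc]]]] := @red_triangle_in_nbhd v.
  by have := red_degree v; lia.
by case: (red_K4_absurd T9 U).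
Qed.

End SingletonParts.

End TwoColours.

(** * Application to colourings of $K_{j\times s}$ with $s\le 2$ *)

Section MultipartiteColouring.

Variables j s : nat.
Local Notation K := (complete_multipartite j s).

Lemma card_off_parts (A : {set 'I_j}) : #|[set w : K | w.1 \notin A]| = (j - #|A|) * s.
Proof.
have -> : [set w : K | w.1 \notin A] = setX (~: A) setT.
  by apply/setP => -[p k]; rewrite !inE andbT.
by rewrite cardsX cardsT card_ord cardsCs setCK card_ord.
Qed.

Lemma card_off_part (v : K) : #|[set w : K | val w.1 != val v.1]| = (j - 1) * s.
Proof. by rewrite -(cards1 v.1) -card_off_parts; apply: eq_card => w; rewrite !inE. Qed.

(** Only an inequality, as the three vertices may share parts. *)
Lemma card_off_three_parts (x y z : K) :
  (j - 3) * s <= #|[set w : K | val w.1 \notin [:: val x.1; val y.1; val z.1]]|.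
Proof.
have -> : [set w : K | val w.1 \notin [:: val x.1; val y.1; val z.1]]
    = [set w : K | w.1 \notin [set x.1; y.1; z.1]].
  by apply/setP => w; rewrite !inE !val_eqE orbA.
rewrite card_off_parts leq_mul2r leq_sub2l ?orbT //.
rewrite setUAC -setUA; apply: leq_trans (leq_card_setU _ _) _; rewrite cards1 cards2.
by case: (_ != _).
Qed.

Variable c : coloring K.
Hypothesis no_red : ~~ contains_copy (red_graph c) butterfly.
Hypothesis no_blue : ~~ contains_copy (blue_graph c) K13_plus_e.
Hypothesis s2 : s <= 2.

Let part (w : K) : nat := val w.1.
Let red : rel K := color_rel c true.
Let blue : rel K := color_rel c false.

Lemma cover_part x y : part x != part y -> red x y || blue x y.
Proof.
by rewrite /red /blue /color_rel /= /multipartite_rel -val_eqE => ->; case: (c _).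
Qed.

Lemma red_butterfly_free v a b d e : uniq [:: v; a; b; d; e] ->
  red v a -> red v b -> red a b -> red v d -> red v e -> red d e -> False.
Proof.
move=> U va vb ab vd ve de; apply: (negP no_red).
exact: (@contains_butterfly (red_graph c) v a b d e).
Qed.

Lemma blue_paw_free x y z w : uniq [:: x; y; z; w] ->
  blue x y -> blue x z -> blue y z -> blue x w -> False.
Proof.
move=> U xy xz yz xw; apply: (negP no_blue).
exact: (@contains_K13_plus_e (blue_graph c) x y z w).
Qed.

Lemma at_most_two_per_part a b d : uniq [:: a; b; d] ->
  part a = part b -> part b = part d -> False.
Proof.
case: a b d => [pa ka] [pb kb] [pd kd]; rewrite /part /= !inE negb_or andbT.
move=> U /val_inj ab /val_inj bd; subst pa pb; move: U.
rewrite !xpair_eqE !eqxx -!val_eqE /=.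
have := ltn_ord ka; have := ltn_ord kb; have := ltn_ord kd; lia.
Qed.

(** The bound provides six vertices off the triangle; it is attained at $(j,s)=(6,2)$ and
    $(9,1)$. *)
Lemma multipartite_blue_triangle_free : 6 <= (j - 3) * s ->
  forall x y z, uniq [:: x; y; z] -> blue x y -> blue x z -> blue y z -> False.
Proof.
move=> js x y z; apply: (@blue_triangle_free _ part red blue) => //.
- exact: color_sym.
- exact: color_sym.
- exact: cover_part.
- exact: red_butterfly_free.
- exact: blue_paw_free.
- exact: at_most_two_per_part.
- exact: leq_trans js (card_off_three_parts _ _ _).
Qed.

(** A vertex has at most five red and four blue neighbours, whereas $K_{6\times 2}$ is already
    10-regular. *)
Lemma multipartite_colouring_small : 0 < j -> 0 < s -> 6 <= (j - 3) * s ->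
  (j - 1) * s < 10.
Proof.
move=> j0 s0 /multipartite_blue_triangle_free bt.
pose v : K := (Ordinal j0, Ordinal s0).
rewrite -(card_off_part v).
apply: leq_ltn_trans (red_degree cover_part red_butterfly_free at_most_two_per_part bt v) _.
rewrite -[10]/(6 + 4) ltn_add2r.
exact: (red_degree_lt6 cover_part red_butterfly_free at_most_two_per_part bt).
Qed.

Lemma singleton_colouring_small : s = 1 -> j < 9.
Proof.
move=> s1; rewrite ltnNge; apply/negP => j9.
have /multipartite_blue_triangle_free bt : 6 <= (j - 3) * s by rewrite s1; lia.
apply: (nine_vertices_absurd _ cover_part red_butterfly_free at_most_two_per_part bt).
- exact: color_sym.
- move=> [p k] [q l] /val_inj /= ->; congr (_, _); apply: val_inj => /=.
  by have := ltn_ord k; have := ltn_ord l; lia.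
- by rewrite card_prod !card_ord s1 muln1.
Qed.

End MultipartiteColouring.

(** * Upper bounds *)

Lemma arrowsP (F B G : sgraph) :
  reflect (forall c : coloring F, ~~ contains_copy (red_graph c) B ->
             ~~ contains_copy (blue_graph c) G -> False) (arrows F B G).
Proof.
apply: (iffP forallP) => [arr c nr nb|arr c].
  by move: (arr c); rewrite (negbTE nr) (negbTE nb).
by apply/negPn/negP; rewrite negb_or => /andP[]; apply: arr.
Qed.

Lemma arrows_two j : 6 <= j -> arrows (complete_multipartite j 2) butterfly K13_plus_e.
Proof.
move=> j6; apply/arrowsP => c nr nb.
by have := multipartite_colouring_small nr nb; lia.
Qed.

Lemma arrows_one j : 9 <= j -> arrows (complete_multipartite j 1) butterfly K13_plus_e.
Proof.
move=> j9; apply/arrowsP => c nr nb.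
by have := singleton_colouring_small nr nb; lia.
Qed.

(** * Lower bounds by explicit colourings *)

Lemma not_arrows_zero j : ~~ arrows (complete_multipartite j 0) butterfly K13_plus_e.
Proof.
apply/arrowsP => /(_ [ffun=> true]); apply; apply/contains_copyP => -[f _ _].
  by case: (f ord0).2.
by case: (f ord0).2.
Qed.

Lemma not_arrows_two_K4 j : j <= 8 ->
  ~~ arrows (complete_multipartite j 1) butterfly K13_plus_e.
Proof.
move=> j8; set K := complete_multipartite j 1.
pose half (w : K) := w.1 %/ 4.
have [|c cP] := @coloring_of_rel K (fun x y => half x == half y).
  by move=> x y; rewrite eq_sym.
apply/arrowsP => /(_ c); apply; apply/negP.
  have col x y : @adj (red_graph c) x y -> half x = half y.
    by rewrite /= cP => /andP[_ /eqP/eqP].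
  move=> /(butterfly_connected col)[f injf fhalf].
  (* A red butterfly stays within one half, where the index modulo 4 determines the vertex. *)
  have : #|'I_5| <= #|'I_4|; last by rewrite !card_ord.
  pose g i : 'I_4 := inord ((f i).1 %% 4).
  apply: (@leq_card _ _ g) => i k /(congr1 val); rewrite /= !inordK ?ltn_pmod //.
  move=> eqm; apply: injf; have := fhalf i k; rewrite /half => eqd.
  case: (f i) (f k) eqm eqd => [p x] [q y] /= eqm eqd; congr (_, _).
    by apply: val_inj => /=; rewrite (divn_eq p 4) (divn_eq q 4) eqm eqd.
  by rewrite (ord1 x) (ord1 y).
move=> /K13_plus_e_triangle[x [y [z []]]].
rewrite /= !cP => /andP[_ xy] /andP[_ xz] /andP[_ yz].
(* Blue edges change [half], which takes two values, so blue is bipartite. *)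
have lt2 w : half w < 2 by rewrite /half ltn_divLR //; apply: leq_trans (ltn_ord _) _.
have := lt2 x; have := lt2 y; have := lt2 z; lia.
Qed.

Lemma not_arrows_pentagon j s : j <= 5 ->
  ~~ arrows (complete_multipartite j s) butterfly K13_plus_e.
Proof.
move=> j5; set K := complete_multipartite j s.
(* With truncated subtraction this is the absolute difference. Modulo 5 the differences 1 and 4 give
   one pentagon, 2 and 3 the complementary one. *)
pose dist (x y : K) := (x.1 - y.1) + (y.1 - x.1).
have [|c cP] := @coloring_of_rel K (fun x y => dist x y \in [:: 1; 4]).
  by move=> x y; rewrite /dist addnC.
have lt5 (w : K) : w.1 < 5 by apply: leq_trans (ltn_ord _) _.
have no_mono b x y z :
    color_rel c b x y -> color_rel c b x z -> color_rel c b y z -> False.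
  rewrite !cP /dist /= /multipartite_rel -!val_eqE /= !inE.
  have := lt5 x; have := lt5 y; have := lt5 z.
  move: (nat_of_ord x.1) (nat_of_ord y.1) (nat_of_ord z.1).
  by case: b => -[|[|[|[|[|p]]]]] [|[|[|[|[|q]]]]] [|[|[|[|[|r]]]]].
apply/arrowsP => /(_ c); apply; apply/negP.
  by move=> /butterfly_triangle[x [y [z [xy xz yz]]]]; apply: no_mono xy xz yz.
by move=> /K13_plus_e_triangle[x [y [z [xy xz yz]]]]; apply: no_mono xy xz yz.
Qed.

(** * From arrowing to the Ramsey number *)

Lemma size_multipartite_ramsey_some j s B G :
  arrows (complete_multipartite j s) B G ->
  (forall t, t < s -> ~~ arrows (complete_multipartite j t) B G) ->
  size_multipartite_ramsey j B G = Some s.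
Proof.
move=> arr narr; rewrite /size_multipartite_ramsey.
case: excluded_middle_informative => [ex|[]]; last by exists s.
congr Some; case: ex_minnP => m arrm minm; apply/eqP.
by rewrite eqn_leq minm //= leqNgt; apply/negP => /narr; rewrite arrm.
Qed.

Lemma size_multipartite_ramsey_none j B G :
  (forall s, ~~ arrows (complete_multipartite j s) B G) ->
  size_multipartite_ramsey j B G = None.
Proof.
move=> narr; rewrite /size_multipartite_ramsey.
case: excluded_middle_informative => // ex; exfalso.
by case: ex => s; apply/negP.
Qed.

Theorem theorem3p7 (j : nat) (hj : 3 <= j) :
  size_multipartite_ramsey j butterfly K13_plus_e =
    if j \in [:: 3; 4; 5] then None
    else if j \in [:: 6; 7; 8] then Some 2
    else Some 1.
Proof.
rewrite !inE; case: ifP => [j5|nj5].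
  by apply: size_multipartite_ramsey_none => s; apply: not_arrows_pentagon; lia.
case: ifP => [j8|nj8]; apply: size_multipartite_ramsey_some.
- by apply: arrows_two; lia.
- move=> [|[|//]] _; first exact: not_arrows_zero.
  by apply: not_arrows_two_K4; lia.
- by apply: arrows_one; lia.
- by move=> [|//] _; apply: not_arrows_zero.
Qed.
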